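(* Let $\mathcal{I}$ be a proper admissible ideal on $\mathbb{N}$. For a Tychonoff space $X$ the following assertions are equivalent. (1) $C_p(X)$ is separable and $\mathcal{I}$-weakly Fr\'echet in the strict sense. (2) $C_p(X)$ is separable and $\mathcal{I}$-weakly Fr\'echet in the strict sense with respect to dense subspaces. (3) $C_p(X)$ is $\mathcal{I}$-H-separable. (4) The $i$-weight of $X$ is countable, i.e. $iw(X)\leq\omega$, and every finite power of $X$ is $\mathcal{I}$-Hurewicz.
   Context: An ideal on $\mathbb{N}$ is a family of subsets of $\mathbb{N}$ closed under finite unions and under subsets; it is admissible if it contains every singleton and proper if it does not contain $\mathbb{N}$. $C_p(X)$ is the set of continuous functions $X\to\mathbb{R}$ with the topology of pointwise convergence. A space $Z$ is $\mathcal{I}$-H-separable if for every sequence $(Y_n)_{n\in\mathbb{N}}$ of dense subspaces of $Z$ there is a sequence $(F_n)_{n\in\mathbb{N}}$ such that each $F_n$ is a finite subset of $Y_n$ and for every nonempty open set $U$ of $Z$, $\{n\in\mathbb{N} : U\cap F_n=\emptyset\}\in\mathcal{I}$. A space $Z$ is $\mathcal{I}$-weakly Fr\'echet in the strict sense if for any $z\in Z$ and any sequence $(Y_n)$ of subsets of $Z$ with $z\in\bigcap_{n}\overline{Y_n}$ there is a sequence $(F_n)$ such that each $F_n$ is a finite subset of $Y_n$ and for every neighbourhood $U$ of $z$, $\{n\in\mathbb{N}: U\cap F_n=\emptyset\}\in\mathcal{I}$. It is $\mathcal{I}$-weakly Fr\'echet in the strict sense with respect to dense subspaces if for any $z\in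 Z$ and any sequence $(Y_n)$ of dense subspaces of $Z$ there is a sequence $(F_n)$ such that each $F_n$ is a finite subset of $Y_n$ and for every neighbourhood $U$ of $z$, $\{n\in\mathbb{N}: U\cap F_n=\emptyset\}\in\mathcal{I}$. The $i$-weight $iw(X)$ of $(X,\tau)$ is the least weight of a Tychonoff topology $\tau'\subseteq\tau$ on $X$. A space $Z$ is $\mathcal{I}$-Hurewicz if for each sequence $(\mathcal{U}_n)$ of open covers of $Z$ there is a sequence $(\mathcal{V}_n)$ such that each $\mathcal{V}_n$ is a finite subset of $\mathcal{U}_n$ and for each $z\in Z$, $\{n\in\mathbb{N}: z\notin\bigcup\mathcal{V}_n\}\in\mathcal{I}$. *)

(* Defs.v *)
From HB Require Import structures.
From mathcomp Require Import all_boot all_order all_algebra.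
From mathcomp Require Import all_classical all_reals all_analysis.

Set Implicit Arguments.
Unset Strict Implicit.
Unset Printing Implicit Defensive.

Import numFieldNormedType.Exports.

Local Open Scope classical_set_scope.
Local Open Scope card_scope.

Section ideals.

Definition set_ideal (I : set (set nat)) :=
  [/\ I set0,
      forall A B, I A -> I B -> I (A `|` B)
    & forall A B, A `<=` B -> I B -> I A].

Definition admissible_ideal (I : set (set nat)) := forall n, I [set n].

Definition proper_set_ideal (I : set (set nat)) := ~ I [set: nat].

End ideals.

Section selection_properties.
Variables (I : set (set nat)) (Z : topologicalType).

Definition separable_space := exists2 D : set Z, countable D & dense D.

Definition finite_selection {T : Type} (F Y : nat -> set T) :=
  forall n, finite_set (F n) /\ F n `<=` Y n.

Definition ideal_H_separable :=
  forall Y : nat -> set Z, (forall n, dense (Y n)) ->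
  exists2 F : nat -> set Z, finite_selection F Y &
    forall U, open U -> U !=set0 -> I [set n | U `&` F n = set0].

Definition ideal_weakly_Frechet_strict :=
  forall (z : Z) (Y : nat -> set Z), (\bigcap_n closure (Y n)) z ->
  exists2 F : nat -> set Z, finite_selection F Y &
    forall U, nbhs z U -> I [set n | U `&` F n = set0].

Definition ideal_weakly_Frechet_strict_dense :=
  forall (z : Z) (Y : nat -> set Z), (forall n, dense (Y n)) ->
  exists2 F : nat -> set Z, finite_selection F Y &
    forall U, nbhs z U -> I [set n | U `&` F n = set0].

Definition open_cover (C : set (set Z)) :=
  C `<=` open /\ \bigcup_(A in C) A = [set: Z].

Definition ideal_Hurewicz :=
  forall C : nat -> set (set Z), (forall n, open_cover (C n)) ->
  exists2 V : nat -> set (set Z), finite_selection V C &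
    forall z, I [set n | ~ (\bigcup_(A in V n) A) z].

End selection_properties.

Definition tychonoff_space (T : topologicalType) :=
  completely_regular_space T /\ hausdorff_space T.

Section i_weight.

(* There is no type of cardinals: a cardinal defined as the least cardinality
   of a member of a family is represented by a member that attains it. *)
Definition least_card {T : Type} (F : set (set T)) (K : set T) :=
  F K /\ forall L, F L -> K #<= L.

Definition is_weight (T : topologicalType) (K : set (set T)) :=
  least_card (@basis T) K.

Definition coarser (X : topologicalType) (t : Topological X) :=
  forall A : set X, @open (Topological.Pack t) A -> @open X A.

Definition is_iweight (X : topologicalType) (K : set (set X)) :=
  least_card
    [set B : set (set X) | exists t : Topological X,
      [/\ coarser t, tychonoff_space (Topological.Pack t)
        & @is_weight (Topological.Pack t) B]] K.

Definition countable_iweight (X : topologicalType) :=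
  exists2 K : set (set X), is_iweight K & K #<= [set: nat].

End i_weight.

(* The subspace topology inherited from the product topology on X -> R. *)
Definition C_p (X : topologicalType) (R : realType) : topologicalType :=
  initial_topology (fun f : continuousType X R => (f : X -> R) : {ptws X -> R}).

Definition finite_power (X : topologicalType) (n : nat) : topologicalType :=
  {ptws 'I_n -> X}.

(* Main.v *)
Require Import Defs.
From HB Require Import structures.
From mathcomp Require Import all_boot all_order all_algebra.
From mathcomp Require Import all_classical all_reals all_analysis.
From mathcomp Require Import lra.

(** The first property implies the second because every point is in the closure
    of every dense set.

    The second implies H-separability by applying the local property at the
    points of a countable dense set and merging the countably many resulting
    selections diagonally; what the merge loses is a finite set of stages for
    each point, and an admissible ideal contains the finite sets
    ([separable_weakly_Frechet_H_separable]).

    From H-separability to the condition on X: since the ideal is proper, C_p(X)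
    is separable, and a countable dense set of functions induces on X a coarser
    second countable Tychonoff topology ([separable_C_p_countable_iweight]).
    Next, an open cover C of the k-th power of X is encoded by the set of the
    functions f such that a finite part of C covers all k-tuples of points where
    f differs from 1. This set is dense ([dense_covered_where_not_one]), and
    finitely many of its members give finitely many members of C. H-separability
    applied to the sets encoding a sequence of covers thus yields the Hurewicz
    selection ([H_separable_C_p_Hurewicz]).

    Conversely, a coarser second countable Tychonoff topology provides countably
    many functions whose rational combinations are dense in C_p(X)
    ([countable_iweight_separable_C_p]). If g is in the closure of each Y n, the
    sets of k-tuples on which some f in Y n is 1/(n+1)-close to g form an open
    cover of the k-th power; the Hurewicz selections for all k, merged
    diagonally, give the finite subsets of the Y n that approach g
    ([Hurewicz_C_p_weakly_Frechet]). *)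

Set Implicit Arguments.
Unset Strict Implicit.
Unset Printing Implicit Defensive.

Import Order.TTheory GRing.Theory Num.Theory numFieldNormedType.Exports.

Local Open Scope classical_set_scope.
Local Open Scope ring_scope.

(** * Neighbourhoods in pointwise topologies *)

Lemma filter_all_seq (T : Type) (J : eqType) (F : set_system T) {FF : Filter F}
    (s : seq J) (P : J -> set T) :
  (forall i, F (P i)) -> F [set x | forall i, i \in s -> P i x].
Proof.
move=> FP; elim: s => [|i s IHs]; first by apply: filterS filterT.
apply: filterS2 (FP i) IHs => x Pix sx j; rewrite inE => /predU1P[->//|].
exact: sx.
Qed.

Lemma nbhs_initialP (S : choiceType) (T : topologicalType) (e : S -> T)
    (x : initial_topology e) (A : set (initial_topology e)) :
  nbhs x A <-> exists2 B, nbhs (e x) B & e @^-1` B `<=` A.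
Proof.
split=> [[U [/= [B oB <-] Bx] BA]|[B eB BA]].
  by exists B => //; exact: open_nbhs_nbhs.
by apply: filterS BA _; exact: (@initial_continuous _ _ e).
Qed.

(** The topology of pointwise convergence is only given as a supremum of
    initial topologies; all later arguments use these finite boxes instead. *)
Lemma nbhs_ptwsP (J : eqType) (T : topologicalType) (f : {ptws J -> T})
    (A : set {ptws J -> T}) :
  nbhs f A <-> exists s : seq J, exists2 U : J -> set T,
    (forall i, nbhs (f i) (U i)) &
    [set g : {ptws J -> T} | forall i, i \in s -> U i (g i)] `<=` A.
Proof.
(* The sets containing a finite box form a filter that converges to f for each
   initial topology, hence for their supremum. *)
pose F : set_system {ptws J -> T} := [set A | exists s : seq J,
  exists2 U : J -> set T, (forall i, nbhs (f i) (U i)) &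
    [set g : {ptws J -> T} | forall i, i \in s -> U i (g i)] `<=` A].
have FF : Filter F.
  split.
  - by exists [::], (fun=> setT) => // i; exact: filterT.
  - move=> B C [s [U nU UB]] [t [V nV VC]].
    exists (s ++ t), (fun i => U i `&` V i); first by move=> i; exact: filterI.
    move=> g gs; split; [apply: UB|apply: VC] => i si.
      by have [] := gs i _; rewrite ?mem_cat ?si.
    by have [] := gs i _; rewrite ?mem_cat ?si ?orbT.
  - move=> B C BC [s [U nU UB]]; exists s, U => //.
    exact: subset_trans BC.
split=> [fA|[s [U nU UA]]].
  suff : F --> f by apply.
  apply/cvg_sup => i B /nbhs_initialP[C fC CB].
  exists [:: i], (fun j => if j == i then C else setT).
    by move=> j; case: eqVneq => [->//|_]; exact: filterT.
  by move=> g /(_ i); rewrite inE eqxx => /(_ isT) /CB.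
apply: filterS UA _.
apply: filter_all_seq => i.
exact: (@proj_continuous J (fun=> T) i f (U i) (nU i)).
Qed.

Section real_valued.
Variable R : realType.

Lemma nbhs_ptws_realP (J : eqType) (f : {ptws J -> R})
    (A : set {ptws J -> R}) :
  nbhs f A <-> exists s : seq J, exists2 eps : R, 0 < eps &
    [set g : {ptws J -> R} | forall i, i \in s -> `|f i - g i| < eps] `<=` A.
Proof.
rewrite nbhs_ptwsP; split=> -[s [U U1 UA]]; exists s; last first.
  exists (fun i => ball (f i) U) => //.
  by move=> i; exact: nbhsx_ballx.
have [eps eps0 epsU] : exists2 eps : R, 0 < eps &
    forall i, i \in s -> ball (f i) eps `<=` U i.
  elim: s {UA} => [|i s [eps eps0 IHs]]; first by exists 1.
  have /nbhs_ballP[d/= d0 dU] := U1 i.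
  exists (Num.min eps d); first by rewrite lt_min eps0.
  move=> j; rewrite inE => /predU1P[->|js].
    by apply: subset_trans dU; apply: le_ball; rewrite ge_min lexx orbT.
  by apply: subset_trans (IHs j js); apply: le_ball; rewrite ge_min lexx.
exists eps => // g gs; apply: UA => i si.
exact/epsU/gs.
Qed.

(** Covers two uses: the topology of C_p(X), with index set X, and the coarser
    topology on X induced by a sequence of functions, with index set nat. *)
Lemma nbhs_initial_realP (S : choiceType) (J : eqType)
    (e : S -> {ptws J -> R}) (x : initial_topology e)
    (A : set (initial_topology e)) :
  nbhs x A <-> exists s : seq J, exists2 eps : R, 0 < eps &
    [set y | forall i, i \in s -> `|e x i - e y i| < eps] `<=` A.
Proof.
rewrite nbhs_initialP; split=> [[B /nbhs_ptws_realP[s [eps eps0 sB]] BA]|].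
  by exists s, eps => // y sy; apply: BA; exact: sB.
move=> [s [eps eps0 sA]].
exists [set g : {ptws J -> R} | forall i, i \in s -> `|e x i - g i| < eps].
  by apply/nbhs_ptws_realP; exists s, eps.
exact: sA.
Qed.

Section C_p_basics.
Variable X : topologicalType.

(** C_p X R is an initial topology, so that its elements do not coerce to
    functions; [C_p_fun] and [to_C_p] go back and forth. *)
Definition C_p_fun (f : C_p X R) : X -> R := (f : continuousType X R).

Definition to_C_p (f : X -> R) (cf : continuous f) : C_p X R :=
  (mkcts cf : continuousType X R).

Definition C_p0 : C_p X R := (cst 0 : continuousType X R).

Lemma C_p_continuous (f : C_p X R) : continuous (C_p_fun f).
Proof. exact: (@cts_fun _ _ (f : continuousType X R)). Qed.

Lemma nbhs_C_pP (f : C_p X R) (A : set (C_p X R)) :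
  nbhs f A <-> exists s : seq X, exists2 eps : R, 0 < eps &
    [set g | forall x, x \in s -> `|C_p_fun f x - C_p_fun g x| < eps] `<=` A.
Proof. exact: nbhs_initial_realP. Qed.

Lemma dense_C_pP (Y : set (C_p X R)) :
  dense Y <-> forall (f : C_p X R) (s : seq X) (eps : R), 0 < eps ->
    exists2 g, Y g & forall x, x \in s -> `|C_p_fun f x - C_p_fun g x| < eps.
Proof.
split=> [dY f s eps eps0|dY O [f Of] oO].
  have : nbhs f [set g | forall x, x \in s -> `|C_p_fun f x - C_p_fun g x| < eps].
    by apply/nbhs_C_pP; exists s, eps.
  rewrite nbhsE => -[W [oW Wf] Ws].
  by have [g [/Ws gs Yg]] := dY W (ex_intro _ f Wf) oW; exists g.
have /nbhs_C_pP[s [eps eps0 sO]] : nbhs f O by exact: open_nbhs_nbhs.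
by have [g Yg gs] := dY f s eps eps0; exists g; split => //; exact: sO.
Qed.

End C_p_basics.

End real_valued.

Lemma nbhs_finite_powerP (X : topologicalType) (n : nat) (x : finite_power X n)
    (A : set (finite_power X n)) :
  nbhs x A <-> exists2 U : 'I_n -> set X, (forall i, nbhs (x i) (U i)) &
    [set y : finite_power X n | forall i, U i (y i)] `<=` A.
Proof.
rewrite nbhs_ptwsP; split=> [[s [U nU UA]]|[U nU UA]].
  by exists U => // y Uy; apply: UA => i _.
exists (enum 'I_n), U => // y Uy; apply: UA => i.
by apply: Uy; rewrite mem_enum.
Qed.

(** * Countable sets and choices *)

Lemma countable_range_sub (T : Type) (t0 : T) (A : set T) :
  countable A -> exists u : nat -> T, A `<=` range u.
Proof.
move=> /pfcard_geP[->|[f]]; first by exists (fun=> t0).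
by exists f => x Ax; have [n _ <-] := @surj _ _ _ _ f x Ax; exists n.
Qed.

(** Take a member with the fewest elements if some member is finite; otherwise
    all members are infinite, and a countable one is least among them. *)
Lemma least_countable_card (T : Type) (F : set (set T)) (L : set T) :
  F L -> countable L -> exists2 K, least_card F K & countable K.
Proof.
move=> FL cL.
have [[n0 Fn0]|nofin] := pselect (exists n, exists2 K, F K & (K #= `I_n)%card).
  have exn : exists n, `[< exists2 K, F K & (K #= `I_n)%card >].
    by exists n0; exact/asboolP.
  case: (ex_minnP exn) => n /asboolP[K FK Kn] minn.
  exists K; last by apply: finite_set_countable; apply/finite_setP; exists n.
  split=> // M FM; rewrite (card_le_eql Kn).
  have [/finite_setP[m Mm]|/infiniteP MI] := pselect (finite_set M).
    rewrite (card_le_eqr Mm) card_le_II; apply: minn; apply/asboolP.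
    by exists M.
  apply: card_le_trans MI; exact: finite_set_countable.
exists L => //; split => // M FM; apply: (card_le_trans cL).
apply/infiniteP => /finite_setP[m Mm]; apply: nofin.
by exists m, M.
Qed.

Lemma choice2 (S T : Type) (P Q : S -> T -> Prop) :
  (forall x, exists2 y, P x y & Q x y) ->
  exists2 f : S -> T, forall x, P x (f x) & forall x, Q x (f x).
Proof.
move=> PQ; have /choice[f fPQ] : forall x, exists y, P x y /\ Q x y.
  by move=> x; have [y] := PQ x; exists y.
by exists f => x; have [] := fPQ x.
Qed.

(** * Selections and ideals *)

Section ideal_selections.
Variables (I : set (set nat)) (idealI : set_ideal I).
Hypothesis admissibleI : admissible_ideal I.

Lemma ideal_subset (A B : set nat) : A `<=` B -> I B -> I A.
Proof. by case: idealI => _ _; apply. Qed.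

Lemma ideal_setU (A B : set nat) : I A -> I B -> I (A `|` B).
Proof. by case: idealI => _ IU _; apply: IU. Qed.

Lemma ideal_initial_segment (k : nat) : I [set n | (n < k)%N].
Proof.
elim: k => [|k IHk]; first by case: idealI => I0 _ _; apply: ideal_subset I0.
apply: ideal_subset (ideal_setU IHk (admissibleI k)) => n /=.
by rewrite ltnS leq_eqVlt => /predU1P[->|]; [right|left].
Qed.

Lemma weakly_Frechet_strict_denseW (Z : topologicalType) :
  ideal_weakly_Frechet_strict I Z -> ideal_weakly_Frechet_strict_dense I Z.
Proof.
move=> wF z Y dY; apply: wF => n _ B.
rewrite nbhsE => -[W [oW Wz] WB].
by have [y [Wy Yy]] := dY n W (ex_intro _ z Wz) oW; exists y; split=> //; exact: WB.
Qed.

(** Countably many finite selections merge into one: stage n uses only the first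
    n + 1 of them, so that the k-th one is missed at finitely many stages only,
    and those stages belong to every admissible ideal. *)
Lemma finite_selection_diagonal (T : Type) (F : nat -> nat -> set T)
    (Y : nat -> set T) :
  (forall k, finite_selection (F k) Y) ->
  finite_selection (fun n => \bigcup_(k in `I_n.+1) F k n) Y.
Proof.
move=> FY n; split.
  by apply: bigcup_finite => [|k _]; [exact: finite_II|have [] := FY k n].
by move=> x [k _ Fx]; have [_] := FY k n; exact.
Qed.

(** Apply the local property at each point of a countable dense set and merge
    the selections: a nonempty open set is a neighbourhood of one of the points. *)
Lemma separable_weakly_Frechet_H_separable (Z : topologicalType) :
  separable_space Z -> ideal_weakly_Frechet_strict_dense I Z ->
  ideal_H_separable I Z.
Proof.
move=> [D cD dD] wF Y dY.
have [[z0 _]|Z0] := pselect (exists z : Z, True); last first.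
  exists (fun=> set0); first by move=> n; split.
  by move=> U _ [z]; case: Z0; exists z.
have [d Dd] := countable_range_sub z0 cD.
have [F FY FI] := choice2 (fun k => wF (d k) Y dY).
exists (fun n => \bigcup_(k in `I_n.+1) F k n).
  exact: finite_selection_diagonal.
move=> U oU U0; have [z [Uz /Dd[k _ dkz]]] := dD U U0 oU.
have /(FI k)/ideal_setU/(_ (ideal_initial_segment k)) : nbhs (d k) U.
  by rewrite dkz; exact: open_nbhs_nbhs.
apply: ideal_subset => n /= UF0; have [nk|kn] := ltnP n k; [by right|left].
rewrite -subset0 => y [Uy Fy]; suff : set0 y by [].
by rewrite -UF0; split=> //; exists k.
Qed.

(** Select from the constant sequence of the whole space: an open set missing
    every selected point would put the set of all stages in the ideal. *)
Lemma H_separable_separable (Z : topologicalType) :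
  proper_set_ideal I -> ideal_H_separable I Z -> separable_space Z.
Proof.
move=> properI HZ; have dT : forall n : nat, dense [set: Z].
  by move=> _ U U0 _; rewrite setIT.
have [F FT FI] := HZ _ dT; exists (\bigcup_n F n).
  apply: bigcup_countable => // n _.
  by apply: finite_set_countable; have [] := FT n.
move=> U U0 oU; apply: contrapT => UF; apply: properI.
apply: ideal_subset (FI U oU U0) => n _ /=; rewrite -subset0 => z [Uz Fz].
by apply: UF; exists z; split=> //; exists n.
Qed.

End ideal_selections.

(** * Bump functions *)

Section bump_functions.
Variables (R : realType) (X : topologicalType).

(** Complete regularity, with the values 0 and 1 exchanged so that the function
    can be used as a multiplier supported in A. *)
Lemma nbhs_bump (x : X) (A : set X) : completely_regular_space X -> nbhs x A ->
  exists f : X -> R, [/\ continuous f, f x = 1 & forall y, ~ A y -> f y = 0].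
Proof.
move=> crX; rewrite nbhsE => -[W [oW Wx] WA].
have : uniform_separator [set x] (~` W) by apply: crX; [exact: open_closedC|].
move=> /uniform_separatorP-/(_ R)[f [cf _ f0 f1]].
exists (fun y => 1 - f y); split.
- by move=> y; apply: cvgB; [exact: cvg_cst|exact: cf].
- by have -> : f x = 0 by [apply: f0; exists x]; rewrite subr0.
- move=> y nAy; have -> : f y = 1 by apply: f1; exists y => // /WA.
  by rewrite subrr.
Qed.

Lemma finite_bump (s : seq X) (A : X -> set X) : completely_regular_space X ->
  (forall x, nbhs x (A x)) ->
  exists f : X -> R, [/\ continuous f, forall x, x \in s -> f x = 1
    & forall y, f y != 0 -> exists2 x, x \in s & A x y].
Proof.
move=> crX nA; elim: s => [|x s [f [cf f1 f0]]].
  by exists (fun=> 0); split=> //; [move=> y; exact: cvg_cst|move=> y; rewrite eqxx].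
have [g [cg g1 g0]] := nbhs_bump crX (nA x).
(* 1 - (1 - f)(1 - g) equals 1 where f or g does, and vanishes where both do. *)
exists (fun y => 1 - (1 - f y) * (1 - g y)); split.
- move=> y; apply: cvgB; first exact: cvg_cst.
  by apply: cvgM; apply: cvgB; [exact: cvg_cst|exact: cf|exact: cvg_cst|exact: cg].
- move=> y; rewrite inE => /predU1P[->|ys]; first by rewrite g1 subrr mulr0 subr0.
  by rewrite f1// subrr mul0r subr0.
- move=> y fgy; have [fy|/f0[z zs Azy]] := eqVneq (f y) 0; last first.
    by exists z => //; rewrite inE zs orbT.
  have [Axy|/g0 gy] := pselect (A x y); first by exists x; rewrite ?inE ?eqxx.
  by move: fgy; rewrite fy gy !subr0 mulr1 subrr eqxx.
Qed.

End bump_functions.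

(** * Separability of function spaces and countable i-weight *)

Lemma injective_continuous_hausdorff (T U : topologicalType) (f : T -> U) :
  continuous f -> injective f -> hausdorff_space U -> hausdorff_space T.
Proof.
move=> cf finj hU p q pq; apply: finj; apply: hU => A B nA nB.
have [z [Az Bz]] := pq _ _ (cf p A nA) (cf q B nB).
by exists (f z).
Qed.

Section iweight.
Variables (R : realType) (X : topologicalType).

Lemma countable_iweight_coarser (t : Topological X) :
  coarser t -> tychonoff_space (Topological.Pack t) ->
  @second_countable (Topological.Pack t) -> countable_iweight X.
Proof.
move=> ct tt [B cB bB].
have [K KB cK] := @least_countable_card _ (@basis (Topological.Pack t)) B bB cB.
have [L LK cL] := @least_countable_card _
  [set B : set (set X) | exists t : Topological X,
      [/\ coarser t, tychonoff_space (Topological.Pack t)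
        & @is_weight (Topological.Pack t) B]] K
  (ex_intro _ t (And3 ct tt KB)) cK.
by exists L.
Qed.

Lemma countable_iweightP : countable_iweight X ->
  exists t : Topological X, [/\ coarser t, tychonoff_space (Topological.Pack t)
    & @second_countable (Topological.Pack t)].
Proof.
by move=> [K [[t [ct tt [bK _]]] _] cK]; exists t; split=> //; exists K.
Qed.

Lemma continuous_coarser (t : Topological X) (T : topologicalType) (f : X -> T) :
  coarser t -> continuous (f : Topological.Pack t -> T) -> continuous f.
Proof. by move=> ct /continuousP cf; apply/continuousP => A /cf /ct. Qed.

Definition rational_box (e : X -> {ptws nat -> R}) (l : seq (nat * rat * rat)) :
    set (initial_topology e) :=
  [set y | forall p, p \in l -> ratr p.1.2 < e y p.1.1 < ratr p.2].
Arguments rational_box : clear implicits.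

(** Rational boxes over finitely many coordinates form a countable base. *)
Lemma second_countable_initial (e : X -> {ptws nat -> R}) :
  @second_countable (initial_topology e).
Proof.
have ce k : continuous (fun y : initial_topology e => e y k).
  move=> y; apply: (@continuous_comp _ _ _ (e : initial_topology e -> _) (proj k)).
    exact: initial_continuous.
  exact: proj_continuous.
exists (range (rational_box e)).
  exact: (card_le_trans (card_image_le _ _) (countableP _)).
split=> [_ [l _ <-]|x A].
  rewrite openE => y ly; rewrite /interior.
  have : forall p : nat * rat * rat, nbhs y [set z : initial_topology e |
      p \in l -> ratr p.1.2 < e z p.1.1 < ratr p.2].
    move=> p; have [pl|pl] := boolP (p \in l); last first.
      by apply: filterS filterT.
    have : nbhs (e y p.1.1) [set r : R | ratr p.1.2 < r < ratr p.2].
      have /andP[y1 y2] := ly p pl.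
      by apply: filterS2 (lt_nbhsr y1) (lt_nbhsl y2) => r /= -> ->.
    move=> /(ce p.1.1 y) nA; apply: (@filterS _ (nbhs y) _ _ _ _ nA) => z ez _; exact: ez.
  by move=> /(filter_all_seq l); apply: filterS => z lz p pl; exact: lz.
move=> /nbhs_initial_realP[s [eps eps0 sA]].
have /choice[ab abP] : forall k, exists ab : rat * rat,
    [/\ ratr ab.1 < e x k < ratr ab.2, e x k - eps < ratr ab.1 &
      ratr ab.2 < e x k + eps].
  move=> k.
  have [a] := @rat_in_itvoo R (e x k - eps) (e x k) ltac:(lra).
  have [b] := @rat_in_itvoo R (e x k) (e x k + eps) ltac:(lra).
  rewrite !in_itv/= => /andP[b1 b2] /andP[a1 a2].
  by exists (a, b); rewrite /= a2 b1.
exists (rational_box e [seq (k, (ab k).1, (ab k).2) | k <- s]).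
  split; first by exists [seq (k, (ab k).1, (ab k).2) | k <- s].
  by move=> _ /mapP[k ks ->] /=; have [] := abP k.
move=> y ly; apply: sA => k ks /=.
have /andP[/= y1 y2] := ly _ (map_f (fun k => (k, (ab k).1, (ab k).2)) ks).
have [/andP[a1 a2] a3 a4] := abP k.
by rewrite ltr_norml; apply/andP; split; lra.
Qed.

(** A countable dense set of functions separates the points of X, because it
    approximates a bump function at any two given points; the topology that it
    induces on X is therefore coarser, Tychonoff and second countable. *)
Lemma separable_C_p_countable_iweight :
  tychonoff_space X -> separable_space (C_p X R) -> countable_iweight X.
Proof.
move=> [crX hX] [D cD dD].
have [d Dd] := countable_range_sub (C_p0 R X) cD.
(* X maps injectively and continuously into a countable power of the line. *)
pose e x : {ptws nat -> R} := fun n => C_p_fun (d n) x.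
have ce : continuous (e : X -> {ptws nat -> R}).
  move=> x A /nbhs_ptws_realP[s [eps eps0 sA]].
  have : forall n, nbhs x [set y | `|e x n - e y n| < eps].
    move=> n; have /cvgrPdist_lt := @C_p_continuous _ _ (d n) x.
    exact.
  move=> /(filter_all_seq s); apply: filterS => y ys; exact: sA.
have inje : injective e.
  move=> x y exy; apply: contrapT => /eqP xy.
  have clx : closed [set y].
    exact/accessible_closed_set1/hausdorff_accessible.
  have nx : nbhs x (~` [set y]).
    by apply: open_nbhs_nbhs; split; [exact: closed_openC|exact/eqP].
  have [f [cf fx fy]] := nbhs_bump R crX nx.
  have /dense_C_pP/(_ (to_C_p cf) [:: x; y] (1 / 2) ltac:(lra))[g Dg gxy] := dD.
  have [n _ dn] := Dd g Dg.
  have := gxy x; rewrite inE eqxx => /(_ isT).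
  have := gxy y; rewrite !inE eqxx orbT => /(_ isT).
  have -> : C_p_fun (to_C_p cf) x = 1 by [].
  have -> : C_p_fun (to_C_p cf) y = 0 by apply: fy => /(_ erefl).
  have : C_p_fun g x = C_p_fun g y by rewrite -dn -![C_p_fun _ _]/(e _ n) exy.
  by move=> {exy} ->; rewrite !ltr_norml => /andP[? ?] /andP[? ?]; lra.
apply: (@countable_iweight_coarser (Topological.class (initial_topology e))).
- by move=> A [B oB <-]; move/continuousP : ce; apply.
- split.
    exact: (@uniform_completely_regular R (initial_topology e)).
  apply: (@injective_continuous_hausdorff (initial_topology e) _ e) => //.
    exact: initial_continuous.
  by apply: hausdorff_product => _; exact: Rhausdorff.
- exact: second_countable_initial.
Qed.

End iweight.

Section separability.
Variables (R : realType) (X : topologicalType).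

(** Being nonzero on U is enough for approximation, since a rational scaling
    then brings f close to any prescribed value at any one point of U. *)
Definition separates (U V : set X) (f : X -> R) :=
  (forall x, U x -> f x != 0) /\ (forall x, ~ V x -> f x = 0).

Definition rational_combination (phi : nat -> nat -> X -> R)
    (l : seq (rat * nat * nat)) (x : X) : R :=
  \sum_(p <- l) ratr p.1.1 * phi p.1.2 p.2 x.

Lemma rational_combination_continuous (phi : nat -> nat -> X -> R) l :
  (forall u v, continuous (phi u v)) -> continuous (rational_combination phi l).
Proof.
move=> cphi; elim: l => [|p l IHl].
  have -> : rational_combination phi [::] = cst 0.
    by apply/funext => x; rewrite /rational_combination big_nil.
  by move=> x; exact: cvg_cst.
have -> : rational_combination phi (p :: l) =
    fun x => ratr p.1.1 * phi p.1.2 p.2 x + rational_combination phi l x.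
  by apply/funext => x; rewrite /rational_combination big_cons.
move=> x; apply: cvgD; last exact: IHl.
by apply: cvgM; [exact: cvg_cst|exact: cphi].
Qed.

Lemma rational_scaling (a b eps : R) : b != 0 -> 0 < eps ->
  exists q : rat, `|a - ratr q * b| < eps.
Proof.
move=> b0 eps0.
have db : 0 < eps / `|b| by rewrite divr_gt0// normr_gt0.
have [q] := @rat_in_itvoo R (a / b - eps / `|b|) (a / b + eps / `|b|) ltac:(lra).
rewrite in_itv/= => /andP[q1 q2]; exists q.
have -> : a - ratr q * b = (a / b - ratr q) * b.
  by rewrite mulrBl divfK.
rewrite normrM -ltr_pdivlMr ?normr_gt0// ltr_norml; apply/andP; split; lra.
Qed.

(** For each pair (U, V) of members of a countable base of the coarser topology,
    choose a function nonzero on U and zero outside V, if there is one. The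
    rational combinations of these functions are countably many. They are dense:
    given finitely many points, take for each of them a V avoiding the others;
    the corresponding functions can then be scaled independently. *)
Lemma countable_iweight_separable_C_p :
  countable_iweight X -> separable_space (C_p X R).
Proof.
move=> /countable_iweightP[t [ct [crt hT] [B cB [oB bB]]]].
have [b Bb] := countable_range_sub (set0 : set X) cB.
have /choice2[phi0 cphi0 phi0P] : forall uv : nat * nat, exists2 f : X -> R,
    continuous f & (exists2 h : X -> R, continuous h & separates (b uv.1) (b uv.2) h) ->
      separates (b uv.1) (b uv.2) f.
  move=> uv; have [[h ch hP]|noh] := pselect (exists2 h : X -> R,
      continuous h & separates (b uv.1) (b uv.2) h); first by exists h.
  by exists (cst 0) => //; move=> x; exact: cvg_cst.
pose phi u v := phi0 (u, v).
have cphi u v : continuous (phi u v) by exact: cphi0.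
exists (range (fun l => to_C_p (@rational_combination_continuous phi l cphi))).
  exact: (card_le_trans (card_image_le _ _) (countableP _)).
apply/dense_C_pP => f s eps eps0.
have /choice[p pP] : forall x, exists p : rat * nat * nat, x \in s ->
    `|C_p_fun f x - ratr p.1.1 * phi p.1.2 p.2 x| < eps /\
    forall z, z \in s -> z != x -> phi p.1.2 p.2 z = 0.
  move=> x; have [xs|] := boolP (x \in s); last by exists (0, 0%N, 0%N).
  pose S : set (Topological.Pack t) := [set z | z \in s /\ z != x].
  have nS : nbhs (x : Topological.Pack t) (~` S).
    apply: open_nbhs_nbhs; split; last by move=> [_]; rewrite eqxx.
    apply: closed_openC; move/hausdorff_accessible: hT => /accessible_finite_set_closed.
    apply; apply: sub_finite_set (finite_seq s) => z []//.
  (* V isolates x from the rest of s, and U is a neighbourhood of x on which a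
     bump function supported in V does not vanish. *)
  have [V [BV Vx] VS] := bB x _ nS.
  have [v _ bv] := Bb V BV.
  have nV : nbhs (x : Topological.Pack t) V.
    by apply: open_nbhs_nbhs; split => //; exact: oB.
  have [h [ch hx hV]] := nbhs_bump R crt nV.
  have nh : nbhs (x : Topological.Pack t) [set y | h y != 0].
    have : nbhs (h x) [set r : R | r != 0].
      by apply: open_nbhs_nbhs; split; [exact: open_neq|rewrite /= hx oner_neq0].
    exact: ch.
  have [U [BU Ux] Uh] := bB x _ nh.
  have [u _ bu] := Bb U BU.
  have [phi1 phi2] : separates (b u) (b v) (phi u v).
    apply: (phi0P (u, v)); exists h; first exact: continuous_coarser ch.
    by rewrite /= bu bv; split.
  have phix : phi u v x != 0 by apply: phi1; rewrite bu.
  have [q qP] := rational_scaling (C_p_fun f x) phix eps0.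
  exists (q, u, v) => _; split=> // z zs zx /=.
  by apply: phi2; rewrite bv => /VS; apply.
pose l := [seq p x | x <- undup s].
exists (to_C_p (@rational_combination_continuous phi l cphi)); first by exists l.
move=> x xs; have [pxs _] := pP x xs.
rewrite -[C_p_fun (to_C_p _) x]/(rational_combination phi l x).
rewrite /rational_combination /l big_map (bigD1_seq x) ?mem_undup ?undup_uniq//=.
rewrite big1_seq ?addr0// => y /andP[yx]; rewrite mem_undup => ys.
by have [_ ->] := pP y ys; rewrite ?mulr0// eq_sym.
Qed.

End separability.

(** * Hurewicz property of finite powers *)

Section Hurewicz_powers.
Variables (R : realType) (X : topologicalType).

(** W is a finite part of the cover C witnessing that f differs from 1 only on a
    set whose k-th power is already covered. *)
Definition covered_where_not_one (k : nat) (C : set (set (finite_power X k)))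
    (f : C_p X R) (W : set (set (finite_power X k))) :=
  [/\ finite_set W, W `<=` C &
    forall z : finite_power X k, (forall i, C_p_fun f (z i) != 1) ->
      (\bigcup_(A in W) A) z].

(** Given g and a finite set s of points, each of the finitely many k-tuples of
    points of s has a box neighbourhood inside a member of C. Intersecting the
    sides of these boxes gives neighbourhoods O x of the points x of s such that
    any product of k of them lies in one of finitely many members of C. The
    function that agrees with g on s and equals 1 off the union of the O x is
    the required approximation. *)
Lemma dense_covered_where_not_one (k : nat) (C : set (set (finite_power X k))) :
  completely_regular_space X -> open_cover C ->
  dense [set f | exists W, covered_where_not_one C f W].
Proof.
move=> crX [oC CT]; apply/dense_C_pP => g s eps eps0.
pose pt (q : {ffun 'I_k -> 'I_(size s)}) : finite_power X k :=
  fun i => tnth (in_tuple s) (q i).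
have /choice2[c Cc cU] : forall q, exists2 A, C A & exists2 U : 'I_k -> set X,
    (forall i, nbhs (pt q i) (U i)) &
    [set y : finite_power X k | forall i, U i (y i)] `<=` A.
  move=> q; have [A CA Aq] : (\bigcup_(A in C) A) (pt q) by rewrite CT.
  exists A => //; apply/nbhs_finite_powerP/open_nbhs_nbhs.
  by split=> //; exact: oC.
have /choice2[U nU Uc] := cU.
pose O (x : X) := [set y | forall (q : {ffun 'I_k -> 'I_(size s)}) i,
  pt q i = x -> U q i y].
have nO x : nbhs x (O x).
  apply: filter_forall => q; apply: filter_forall => i.
  have [<-|qx] := pselect (pt q i = x); first by apply: filterS (nU q i).
  by apply: filterS filterT.
have [h [ch h1 h0]] := finite_bump R s crX nO.
have cf : continuous (fun y => 1 + (C_p_fun g y - 1) * h y).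
  move=> y; apply: cvgD; first exact: cvg_cst.
  apply: cvgM; last exact: ch.
  by apply: cvgB; [exact: C_p_continuous|exact: cvg_cst].
exists (to_C_p cf); last first.
  move=> x xs; rewrite -[C_p_fun (to_C_p cf) x]/(1 + (C_p_fun g x - 1) * h x).
  by rewrite h1// mulr1 subrKC subrr normr0.
exists [set c q | q in [set: {ffun 'I_k -> 'I_(size s)}]]; split.
- exact/finite_image/finite_finset.
- by move=> _ [q _ <-].
move=> z fz.
have /choice[q qP] : forall i, exists j : 'I_(size s), O (tnth (in_tuple s) j) (z i).
  move=> i; have /h0[x xs Ox] : h (z i) != 0.
    apply: contraNneq (fz i) => hz.
    by rewrite -[C_p_fun (to_C_p cf) _]/(1 + (C_p_fun g (z i) - 1) * h (z i)) hz mulr0 addr0.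
  by have /tnthP[j jx] : x \in in_tuple s by []; exists j; rewrite -jx.
exists (c (finfun q)); first by exists (finfun q).
by apply: Uc => i; apply: (qP i); rewrite /pt ffunE.
Qed.

(** The dense sets attached to the covers turn a selection of functions into a
    selection of members of the covers. A function f with |f| < 1 at the
    coordinates of a tuple z differs from 1 there, so that its witness covers z:
    the tuple z is tested by the open set of such functions. *)
Lemma H_separable_C_p_Hurewicz (I : set (set nat)) (k : nat) :
  set_ideal I -> completely_regular_space X ->
  ideal_H_separable I (C_p X R) -> ideal_Hurewicz I (finite_power X k).
Proof.
move=> idealI crX HX C oC.
have [F FY FI] := HX _ (fun n => dense_covered_where_not_one crX (oC n)).
have /choice[W WP] : forall nf : nat * C_p X R, exists W, F nf.1 nf.2 ->
    covered_where_not_one (C nf.1) nf.2 W.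
  move=> [n f] /=; have [Ff|] := pselect (F n f); last by exists set0.
  by have [W] := (FY n).2 f Ff; exists W.
exists (fun n => \bigcup_(f in F n) W (n, f)).
  move=> n; split.
    apply: bigcup_finite; first exact: (FY n).1.
    by move=> f Ff; have [] := WP (n, f) Ff.
  by move=> A [f Ff]; have [_ + _] := WP (n, f) Ff; exact.
move=> z; pose N : set (C_p X R) := [set g | forall x, x \in [seq z i | i <- enum 'I_k] ->
    `|C_p_fun (C_p0 R X) x - C_p_fun g x| < 1].
have : nbhs (C_p0 R X) N.
  by apply/nbhs_C_pP; exists [seq z i | i <- enum 'I_k], 1.
rewrite nbhsE => -[V [oV V0] VN].
apply: ideal_subset idealI _ _ _ (FI V oV (ex_intro _ _ V0)) => n /= nW.
rewrite -subset0 => f [Vf Ff]; apply: nW.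
have [_ _ fW] := WP (n, f) Ff.
have [|A WA Az] := fW z; last by exists A => //; exists f.
move=> i; have /(VN f Vf) : z i \in [seq z i | i <- enum 'I_k].
  by apply: map_f; rewrite mem_enum.
rewrite -[X in `|X - _|]/(0 : R) sub0r normrN; apply: contraTneq => ->.
by rewrite normr1 ltxx.
Qed.

(** That g is in the closure of Y n implies that for each k the sets of k-tuples at
    which some f in Y n is 1/(n+1)-close to g cover the k-th power of X, so a
    finite selection from these covers is a finite selection from Y n. The
    selections obtained for the various k are merged; a basic neighbourhood of g
    given by k points and a radius eps is missed only if n < k, or
    1/(n+1) >= eps, or the selection for k misses the tuple of the points. *)
Lemma Hurewicz_C_p_weakly_Frechet (I : set (set nat)) :
  set_ideal I -> admissible_ideal I ->
  (forall k, ideal_Hurewicz I (finite_power X k)) ->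
  ideal_weakly_Frechet_strict I (C_p X R).
Proof.
move=> idealI admissibleI HX g Y gY.
pose agree k n (f : C_p X R) : set (finite_power X k) :=
  [set x | forall i, `|C_p_fun g (x i) - C_p_fun f (x i)| < n.+1%:R^-1].
pose C k n : set (set (finite_power X k)) := agree k n @` Y n.
have oC k n : open_cover (C k n).
  split=> [_ [f _ <-]|].
    rewrite openE => x xf; apply/nbhs_finite_powerP.
    exists (fun=> [set y | `|C_p_fun g y - C_p_fun f y| < n.+1%:R^-1]) => // i.
    have cgf : {for x i, continuous (fun y => `|C_p_fun g y - C_p_fun f y|)}.
      by apply: cvg_norm; apply: cvgB; exact: C_p_continuous.
    exact: (cgf _ (lt_nbhsl (xf i))).
  rewrite -subTset => x _.
  have [] := gY n Logic.I [set f | forall y, y \in [seq x i | i <- enum 'I_k] ->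
      `|C_p_fun g y - C_p_fun f y| < n.+1%:R^-1].
    apply/nbhs_C_pP; exists [seq x i | i <- enum 'I_k], n.+1%:R^-1 => //.
  move=> f [Yf fx]; exists (agree k n f); first by exists f.
  by move=> i; apply: fx; apply: map_f; rewrite mem_enum.
have /choice[F FP] : forall k, exists F : nat -> set (C_p X R), finite_selection F Y /\
    forall x : finite_power X k, I [set n | ~ exists2 f, F n f & agree k n f x].
  move=> k; have [V VC VI] := HX k (C k) (oC k).
  have /choice[sel selP] : forall nA : nat * set (finite_power X k),
      exists f, C k nA.1 nA.2 -> Y nA.1 f /\ agree k nA.1 f = nA.2.
    move=> [n A] /=; have [[f Yf fA]|] := pselect (C k n A); first by exists f.
    by exists g.
  exists (fun n => (fun A => sel (n, A)) @` V n); split=> [n|x].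
    split; first by apply: finite_image; have [] := VC n.
    move=> _ [A VA <-]; have [_ /(_ A VA) CA] := VC n.
    by have [] := selP (n, A) CA.
  apply: (ideal_subset idealI _ (VI x)) => n /= nF [A VA Ax]; apply: nF.
  exists (sel (n, A)); first by exists A.
  have [_ /(_ A VA) CA] := VC n.
  by have [_ /= ->] := selP (n, A) CA.
exists (fun n => \bigcup_(k in `I_n.+1) F k n).
  by apply: finite_selection_diagonal => k; have [] := FP k.
move=> U /nbhs_C_pP[s [eps eps0 sU]].
have [N _ Neps] := near_infty_natSinv_lt (PosNum eps0).
pose x : finite_power X (size s) := tnth (in_tuple s).
have := ideal_setU idealI (ideal_setU idealI
  (ideal_initial_segment idealI admissibleI (size s))
  (ideal_initial_segment idealI admissibleI N)) ((FP (size s)).2 x).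
apply: (ideal_subset idealI) => n /= UF0.
have [nk|kn] := ltnP n (size s); first by left; left.
have [nN|Nn] := ltnP n N; first by left; right.
right=> -[f Ff fx]; suff : set0 f by [].
rewrite -UF0; split; last by exists (size s).
apply: sU => _ /(tnthP (in_tuple s))[i ->].
exact: lt_trans (fx i) (Neps n Nn).
Qed.

End Hurewicz_powers.

Theorem theorem3p32 (R : realType) (I : set (set nat)) (X : topologicalType)
  (idealI : set_ideal I) (admissibleI : admissible_ideal I) (properI : proper_set_ideal I)
  (tychonoffX : tychonoff_space X) :
  [<-> separable_space (C_p X R) /\ ideal_weakly_Frechet_strict I (C_p X R);
       separable_space (C_p X R) /\ ideal_weakly_Frechet_strict_dense I (C_p X R);
       ideal_H_separable I (C_p X R);
       countable_iweight X /\ forall n : nat, ideal_Hurewicz I (finite_power X n)].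
Proof.
have [crX _] := tychonoffX.
tfae.
- by move=> [sepC wF]; split=> //; exact: weakly_Frechet_strict_denseW.
- by move=> [sepC wF]; exact: separable_weakly_Frechet_H_separable.
- move=> HC; split; last by move=> n; exact: H_separable_C_p_Hurewicz HC.
  by apply: separable_C_p_countable_iweight => //; exact: H_separable_separable HC.
- move=> [iwX HX]; split; first exact: countable_iweight_separable_C_p.
  exact: Hurewicz_C_p_weakly_Frechet.
Qed.
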